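(* Let $(G,<)$ be an ordered group, let $1\neq a\in G$, and let $C\rightarrowtail D$ be the convex jump determined by $a$ (thus $a\in D\setminus C$ and $D/C$ is torsion-free abelian). If $D/\langle a,C\rangle$ is torsion free, then there is a discrete right order on $G$ with $a$ as the minimal positive element. Moreover, if also $[a,F]\subseteq E$ for every convex jump $E\rightarrowtail F$ of $(G,<)$, then there is a discrete lexicographic right order on $G$ with $a$ as minimal positive element.
   Context: A right order on a group $G$ is a strict total order $<$ on the set $G$ such that $f<g$ implies $fh<gh$ for all $f,g,h\in G$; it is an order (and $(G,<)$ is an ordered group) if in addition $f<g$ implies $hf<hg$. An element $g$ is positive if $1<g$. A (right) order is discrete if there is an element $a>1$ such that no element of $G$ lies strictly between $1$ and $a$; this $a$ is the minimal positive element. A subset $X$ of a right-ordered group is convex if $x<y<z$ and $x,z\in X$ imply $y\in X$. The set of convex subgroups is linearly ordered by inclusion. A convex jump $C\rightarrowtail D$ is a pair of distinct convex subgroups $C\subset D$ with no convex subgroup strictly between them. The convex jump determined by a nonidentity element $g$ is given by $C=$ the union of all convex subgroups not containing $g$ and $D=$ the intersection of all convex subgroups containing $g$. In an ordered group, for every convex jump $C\rightarrowtail D$, $C$ is normal in $D$ and $D/C$ embeds in the additive group $\mathbb{R}$ by an order-preserving isomorphism onto its image. A series for $G$ is a set $\Sigma=\{H_\lambda\mid\lambda\in\Lambda\}$ of subgroups, with $\Lambda$ totally ordered, such that $\lambda<\mu$ implies $H_\lambda\subset H_\mu$; $\{1\},G\in\Sigma$; $\Sigma$ is closed under arbitrary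 unions and intersections; and whenever $\mu$ immediately follows $\lambda$ in $\Lambda$, $H_\lambda$ is normal in $H_\mu$, with $H_\mu/H_\lambda$ then called a factor. A right order on $G$ is lexicographic if its convex subgroups form a series whose factors (with the induced order) are order isomorphic to subgroups of the additive group of reals. For $a\in G$ and a subgroup $F$, $[a,F]$ denotes the subgroup $\langle a^{-1}f^{-1}af\mid f\in F\rangle$. *)

(* Defs.v *)
From HB Require Import structures.
From mathcomp Require Import all_boot all_order all_algebra.
From mathcomp Require Import boolp classical_sets reals.

Set Implicit Arguments.
Unset Strict Implicit.
Unset Printing Implicit Defensive.

Local Open Scope classical_set_scope.
Local Open Scope group_scope.

(* Groups are arbitrary, possibly infinite, inhabitants of [groupType]; a
   subset is a [set G], and an order is a Prop-valued relation, since the same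
   group carries several of them. *)
Section Groups.
Variable G : groupType.
Implicit Types (A B D H K N X : set G) (S : set (set G)).

Definition subgroup H : Prop :=
  H 1 /\ (forall x y, H x -> H y -> H (x / y)).

Definition generated X : set G := smallest subgroup X.

(* [a, F] = < a^-1 f^-1 a f | f in F > *)
Definition commutator_subgroup (a : G) (F : set G) : set G :=
  generated [set [~ a, f] | f in F].

Definition normal_in H K : Prop :=
  [/\ subgroup H, subgroup K, H `<=` K & forall h k, H h -> K k -> H (h ^ k)].

(* When N is normal in D, the quotient group D / N is the set of cosets of N
   in D, its product is the product of subsets and its identity is N. *)
Definition set_mul A B : set G := [set x * y | x in A & y in B].

Definition set_pow A n : set G := iter n (set_mul A) [set 1].

Definition quotient D N : set (set G) := [set set_mul N [set x] | x in D].

Definition torsion_free_quotient D N : Prop :=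
  forall A n, quotient D N A -> (0 < n)%N -> set_pow A n = N -> A = N.

Definition consecutive S H K : Prop :=
  [/\ S H, S K, H `<` K & forall X, S X -> ~ (H `<` X /\ X `<` K)].

(* The members of a series are strictly increasing in the index, so that the
   totally ordered index set is S itself, ordered by inclusion.  Unions and
   intersections are those of nonempty subfamilies: the empty union is not a
   subgroup. *)
Definition is_series S : Prop :=
  [/\ (forall H, S H -> subgroup H) /\ total_on S (fun H K => H `<=` K),
      S [set 1] /\ S setT,
      forall T : set (set G), T `<=` S -> T !=set0 ->
        S (\bigcup_(H in T) H) /\ S (\bigcap_(H in T) H)
    & forall H K, consecutive S H K -> normal_in H K].

End Groups.

Section Orders.
Variable G : groupType.
Implicit Types (lt : G -> G -> Prop) (C D H K X : set G).

Definition strict_total_order lt : Prop :=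
  [/\ forall x, ~ lt x x,
      forall x y z, lt x y -> lt y z -> lt x z
    & forall x y, [\/ lt x y, x = y | lt y x]].

Definition right_order lt : Prop :=
  strict_total_order lt /\ (forall f g h, lt f g -> lt (f * h) (g * h)).

Definition group_order lt : Prop :=
  right_order lt /\ (forall f g h, lt f g -> lt (h * f) (h * g)).

(* A right order is discrete when some a has this property. *)
Definition minimal_positive lt (a : G) : Prop :=
  lt 1 a /\ (forall x, ~ (lt 1 x /\ lt x a)).

Definition convex lt X : Prop :=
  forall x y z, X x -> X z -> lt x y -> lt y z -> X y.

Definition convex_subgroups lt : set (set G) :=
  [set H | subgroup H /\ convex lt H].

Definition convex_jump lt C D : Prop := consecutive (convex_subgroups lt) C D.

Definition jump_lower lt (g : G) : set G :=
  \bigcup_(H in [set H | convex_subgroups lt H /\ ~ H g]) H.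

Definition jump_upper lt (g : G) : set G :=
  \bigcap_(H in [set H | convex_subgroups lt H /\ H g]) H.

(* The order induced on cosets of a convex subgroup: representatives of
   distinct cosets compare in the same way whichever ones are chosen. *)
Definition coset_lt lt (A B : set G) : Prop :=
  A <> B /\ (exists x y, [/\ A x, B y & lt x y]).

(* The ordered group K / H is isomorphic to the image of phi, a subgroup of
   the additive group R; only the values of phi on K / H matter. *)
Definition archimedean_factor (R : realType) lt H K : Prop :=
  exists phi : set G -> R, forall A B, quotient K H A -> quotient K H B ->
    phi (set_mul A B) = (phi A + phi B)%R /\
    (coset_lt lt A B <-> (phi A < phi B)%R).

Definition lexicographic (R : realType) lt : Prop :=
  is_series (convex_subgroups lt) /\
  (forall H K, convex_jump lt H K -> archimedean_factor R lt H K).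

End Orders.

(* Main.v *)
Require Import Defs.
From mathcomp Require Import all_boot all_order all_algebra.
From mathcomp Require Import boolp classical_sets reals.
From mathcomp Require Import zify ring lra.

(* Write Z = <a> and A = <a, C>.  Since C is invariant under conjugation by a,
   the chain 1 <= Z <= A <= D <= G carries an order on each of its sets of right
   cosets: Z \ A is identified with C, D / A is a torsion-free abelian group,
   and D \ G is ordered because D is convex.  The lexicographic combination of
   these orders is a right order on G in which Z is convex.

   By Hoelder's theorem a jump of (G, <) is the kernel and the domain of a
   monotone real character.  This identifies D / A with a subgroup of R / Q,
   which embeds in R as a complement of the rational subspace Q; so only the
   step Z <= A can fail to have real factors.  When [a, F] is contained in E for
   every jump E >-> F, conjugation by a preserves each jump and its character,
   and the character of a jump E >-> F below C extends to one on Z F. *)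

Set Implicit Arguments.
Unset Strict Implicit.
Unset Printing Implicit Defensive.

Import Order.TTheory GRing.Theory Num.Theory.
Local Open Scope classical_set_scope.
Local Open Scope group_scope.

(** * Subgroups and integer powers *)

Section Subgroups.
Variable G : groupType.
Implicit Types (x y g : G) (H K : set G).

Lemma subgroup1 H : subgroup H -> H 1.
Proof. by case. Qed.

Lemma subgroupV H x : subgroup H -> H x -> H x^-1.
Proof. by case=> H1 HB Hx; rewrite -[x^-1]mul1g; apply: HB. Qed.

Lemma subgroupM H x y : subgroup H -> H x -> H y -> H (x * y).
Proof.
by move=> sH Hx Hy; rewrite -[y]invgK; apply: sH.2 => //; apply: subgroupV.
Qed.

Lemma subgroupVE H x : subgroup H -> H x^-1 -> H x.
Proof. by move=> sH Hx; rewrite -[x]invgK; apply: subgroupV. Qed.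

Lemma subgroupMl H x y : subgroup H -> H x -> H (x * y) -> H y.
Proof.
by move=> sH Hx Hxy; rewrite -(mulKg x y); apply: subgroupM => //; apply: subgroupV.
Qed.

Lemma subgroupMr H x y : subgroup H -> H y -> H (x * y) -> H x.
Proof.
by move=> sH Hy Hxy; rewrite -(mulgK y x); apply: subgroupM => //; apply: subgroupV.
Qed.

Lemma subgroupX H x n : subgroup H -> H x -> H (x ^+ n).
Proof.
move=> sH Hx; elim: n => [|n IHn]; first exact: subgroup1.
by rewrite expgS; apply: subgroupM.
Qed.

Lemma subgroup_set1 : subgroup [set (1 : G)].
Proof. by split=> // x y /= -> ->; rewrite divg1. Qed.

Lemma subgroup_setT : subgroup [set: G].
Proof. by split. Qed.

Definition zpow x (m : int) : G :=
  match m with Posz n => x ^+ n | Negz n => x ^- n.+1 end.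

Lemma zpowS x m : zpow x (m + 1)%R = zpow x m * x.
Proof.
case: m => n; first by rewrite -PoszD addn1 /= expgSr.
have -> : (Negz n + 1 = - n%:Z)%R by rewrite NegzE; lia.
case: n => [|n]; first by rewrite oppr0 /= expg1 mulVg.
rewrite -NegzE /= (expgS x n.+1) invgM.
by rewrite mulgVK.
Qed.

Lemma zpow_pred x m : zpow x (m - 1)%R = zpow x m / x.
Proof. by rewrite -[in RHS](subrK 1%R m) zpowS mulgK. Qed.

Lemma zpowD x m n : zpow x (m + n)%R = zpow x m * zpow x n.
Proof.
elim/int_ind: n => [|n IHn|n IHn]; first by rewrite addr0 mulg1.
  by rewrite -addn1 PoszD addrA zpowS IHn -[(n%:Z + 1)%R]/(n%:Z + 1)%R zpowS mulgA.
have -> : (- n.+1%:Z = - n%:Z - 1)%R by lia.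
by rewrite addrA !zpow_pred IHn mulgA.
Qed.

Lemma zpow1 x : zpow x 1%R = x.
Proof. exact: expg1. Qed.

Lemma zpowN x m : zpow x (- m)%R = (zpow x m)^-1.
Proof. by apply/esym/mulg1_eq; rewrite -zpowD subrr. Qed.

Lemma zpowX x m n : zpow x m ^+ n = zpow x (m * n%:Z)%R.
Proof.
elim: n => [|n IHn]; first by rewrite mulr0.
rewrite expgSr IHn -zpowD; congr zpow; lia.
Qed.

Lemma subgroup_zpow H x m : subgroup H -> H x -> H (zpow x m).
Proof.
move=> sH Hx; case: m => n /=; first exact: subgroupX.
by apply: subgroupV => //; apply: subgroupX.
Qed.

Definition cyclic_subgroup x : set G := [set zpow x m | m in [set: int]].

Lemma subgroup_cyclic x : subgroup (cyclic_subgroup x).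
Proof.
split; first by exists 0%R.
by move=> _ _ [m _ <-] [n _ <-]; exists (m - n)%R; rewrite // zpowD zpowN.
Qed.

End Subgroups.

(** * Inequalities in a two-sided ordered group *)

Section BiOrder.
Variables (G : groupType) (lt : G -> G -> Prop).
Hypothesis lt_ord : group_order lt.
Implicit Types (x y z g : G) (H : set G).

Definition le x y := x = y \/ lt x y.

Lemma lto_irr x : ~ lt x x.
Proof. by case: lt_ord => -[[]]. Qed.

Lemma lto_trans y x z : lt x y -> lt y z -> lt x z.
Proof. by case: lt_ord => -[[_ tr _] _] _; apply: tr. Qed.

Lemma lto_total x y : [\/ lt x y, x = y | lt y x].
Proof. by case: lt_ord => -[[]]. Qed.

Lemma lto_mul2r z x y : lt x y -> lt (x * z) (y * z).
Proof. by case: lt_ord => -[_ mul_r] _; apply: mul_r. Qed.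

Lemma lto_mul2l z x y : lt x y -> lt (z * x) (z * y).
Proof. by case: lt_ord => _ mul_l; apply: mul_l. Qed.

Lemma lto_asym x y : lt x y -> ~ lt y x.
Proof. by move=> xy yx; apply: (@lto_irr x); apply: lto_trans yx. Qed.

Lemma ltoW x y : lt x y -> le x y.
Proof. by right. Qed.

Lemma leoo x : le x x.
Proof. by left. Qed.

Lemma leo_or_lt x y : le x y \/ lt y x.
Proof.
case: (lto_total x y) => [xy|xy|yx]; [left|left|by right].
  exact: ltoW.
by left.
Qed.

Lemma leo_total x y : le x y \/ le y x.
Proof. by case: (leo_or_lt x y) => [?|/ltoW ?]; [left|right]. Qed.

Lemma leo_lt_trans y x z : le x y -> lt y z -> lt x z.
Proof. by move=> [->//|xy yz]; apply: lto_trans yz. Qed.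

Lemma lto_le_trans y x z : lt x y -> le y z -> lt x z.
Proof. by move=> xy [<-//|yz]; apply: lto_trans yz. Qed.

Lemma leo_trans y x z : le x y -> le y z -> le x z.
Proof. by move=> [->//|xy] yz; right; apply: lto_le_trans yz. Qed.

Lemma leo_nlt x y : le x y -> ~ lt y x.
Proof. by move=> xy yx; apply: (@lto_irr x); apply: leo_lt_trans yx. Qed.

Lemma leo_anti x y : le x y -> le y x -> x = y.
Proof. by move=> [//|xy] /leo_nlt. Qed.

Lemma leo_mul2r z x y : le x y -> le (x * z) (y * z).
Proof. by move=> [->|/(lto_mul2r z)/ltoW//]; apply: leoo. Qed.

Lemma leo_mul2l z x y : le x y -> le (z * x) (z * y).
Proof. by move=> [->|/(lto_mul2l z)/ltoW//]; apply: leoo. Qed.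

Lemma leo_mul x y u v : le x y -> le u v -> le (x * u) (y * v).
Proof. by move=> xy uv; apply: (leo_trans (leo_mul2r u xy)); apply: leo_mul2l. Qed.

Lemma leo_exp n x y : le x y -> le (x ^+ n) (y ^+ n).
Proof.
move=> xy; elim: n => [|n IHn]; first exact: leoo.
by rewrite !expgS; apply: leo_mul.
Qed.

Lemma leo_inv x y : le x y -> le y^-1 x^-1.
Proof.
move=> xy; have := leo_mul2r y^-1 (leo_mul2l x^-1 xy).
by rewrite mulVg mul1g mulgK.
Qed.

Lemma leo_conj z x y : le x y -> le (x ^ z) (y ^ z).
Proof. by move=> xy; rewrite !conjgE; apply: leo_mul2l; apply: leo_mul2r. Qed.

Lemma leo1V x : le 1 x \/ le 1 x^-1.
Proof. by case: (leo_total 1 x) => [|/leo_inv]; rewrite ?invg1; [left|right]. Qed.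

Lemma flip_group_order : group_order (fun x y => lt y x).
Proof.
split; last by move=> f g h; apply: lto_mul2l.
split; last by move=> f g h; apply: lto_mul2r.
split; first exact: lto_irr.
  by move=> x y z xy yz; apply: lto_trans xy.
move=> x y; case: (lto_total x y); first by constructor 3.
  by constructor 2.
by constructor 1.
Qed.

End BiOrder.

(** * Hoelder's theorem *)

Section Holder.
Variables (R : realType) (G : groupType) (lt : G -> G -> Prop).
Hypothesis lt_ord : group_order lt.
Variable g : G.
Hypothesis g_gt1 : lt 1 g.
Implicit Types (x y z : G) (m n k : int).
Local Notation "x <o y" := (lt x y) (at level 70).
Local Notation "x <=o y" := (le lt x y) (at level 70).

Lemma zpow_gt1 (n : nat) : 1 <o zpow g n.+1.
Proof.
elim: n => [|n IHn]; first by rewrite zpow1.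
rewrite -[n.+2]addn1 PoszD zpowS.
by apply: (lto_trans lt_ord IHn); rewrite -{1}[zpow _ _]mulg1; apply: lto_mul2l.
Qed.

Lemma zpow_lt m n : (m < n)%R -> zpow g m <o zpow g n.
Proof.
move=> mn; have [k ->] : exists k : nat, n = (m + k.+1%:Z)%R.
  by exists (`|n - m|%N.-1); lia.
by rewrite zpowD -{1}[zpow g m]mulg1; apply: lto_mul2l => //; apply: zpow_gt1.
Qed.

Lemma zpow_le m n : (m <= n)%R -> zpow g m <=o zpow g n.
Proof. by rewrite le_eqVlt => /orP[/eqP->|/zpow_lt]; [left|right]. Qed.

Lemma zpow_le_inv m n : zpow g m <=o zpow g n -> (m <= n)%R.
Proof.
by move=> mn; rewrite leNgt; apply/negP => /zpow_lt; apply: leo_nlt mn.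
Qed.

(** The convex subgroup generated by [g], written through powers of [g] so that each member comes
    with explicit bounds. *)
Definition arch_hull : set G :=
  [set x | exists n : nat, zpow g (- n%:Z)%R <=o x /\ x <=o zpow g n].

Lemma arch_hull_subgroup : subgroup arch_hull.
Proof.
split; first by exists 0%N; split; left.
move=> x y [m [mx xm]] [n [ny yn]]; exists (m + n)%N; split.
  rewrite PoszD opprD zpowD; apply: leo_mul => //.
  by rewrite zpowN; apply: leo_inv.
rewrite PoszD zpowD; apply: leo_mul => //.
by rewrite -[zpow g n]invgK -zpowN; apply: leo_inv.
Qed.

Lemma arch_hull_convex : convex lt arch_hull.
Proof.
move=> x y z [m [mx _]] [n [_ zn]] xy yz; exists (m + n)%N; split.
  apply: (leo_trans lt_ord) (leo_trans lt_ord mx (ltoW xy)).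
  by apply: zpow_le; lia.
apply: (leo_trans lt_ord) (leo_trans lt_ord (ltoW yz) zn) _.
by apply: zpow_le; lia.
Qed.

Lemma arch_hull_gen : arch_hull g.
Proof.
by exists 1%N; split; rewrite -{2}[g]zpow1; [apply: zpow_le|left].
Qed.

Lemma arch_floor x : arch_hull x ->
  exists m, zpow g m <=o x /\ x <=o zpow g (m + 1)%R.
Proof.
move=> [N [Nx xN]].
(* Shifting exponents by [N] turns the search for the least upper power into one over [nat]. If the
   least index is 0, then [x] is at most its own lower bound [zpow g (- N)], and the floor is
   [- N]. *)
have ex : exists k : nat, `[< x <=o zpow g (k%:Z - N%:Z)%R >].
  exists (N + N)%N; apply/asboolP; apply: leo_trans xN _ => //.
  by apply: zpow_le; lia.
case: (ex_minnP ex) => -[|k] /asboolP xk kmin.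
  exists (- N%:Z)%R; split=> //; apply: leo_trans xk _ => //.
  by apply: zpow_le; lia.
exists (k%:Z - N%:Z)%R; split.
  case: (leo_or_lt lt_ord x (zpow g (k%:Z - N%:Z)%R)) => [|/ltoW//].
  by move/asboolP/kmin; rewrite ltnn.
by have <- : (k.+1%:Z - N%:Z = k%:Z - N%:Z + 1)%R by lia.
Qed.

(** The rationals at most the logarithm of [x] to base [g]: [m / n] belongs when the [m]-th power of
    [g] is at most [x ^+ n]. The supremum [slope] is Hoelder's embedding. *)
Definition slopes x : set R :=
  [set q | exists (m : int) (n : nat),
    [/\ (0 < n)%N, zpow g m <=o x ^+ n & q = (m%:~R / n%:R)%R]].

Definition slope x : R := sup (slopes x).

Lemma slopes_ub x m (n : nat) : (0 < n)%N -> x ^+ n <=o zpow g m ->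
  ubound (slopes x) (m%:~R / n%:R)%R.
Proof.
move=> n0 xm _ [k [l [l0 kx ->]]].
(* Cross-multiplication: both inequalities are raised to a common power of [x], with exponent
   [l * n]. *)
have : (k * n%:Z <= m * l%:Z)%R.
  apply: zpow_le_inv; rewrite -!zpowX.
  apply: (leo_trans lt_ord) (leo_exp lt_ord n kx) _.
  by rewrite -expgnA mulnC expgnA; apply: leo_exp.
rewrite -(ler_int R) !intrM -!pmulrn => kn.
by rewrite ler_pdivrMr ?ltr0n // mulrAC ler_pdivlMr ?ltr0n.
Qed.

Lemma slope_le x m (n : nat) : arch_hull x -> (0 < n)%N ->
  x ^+ n <=o zpow g m -> (slope x <= m%:~R / n%:R)%R.
Proof.
move=> /arch_floor[k [kx _]] n0 xm; apply: ge_sup; last exact: slopes_ub.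
by exists (k%:~R / 1%:R)%R, k, 1%N; rewrite expg1.
Qed.

Lemma slope_ge x m (n : nat) : arch_hull x -> (0 < n)%N ->
  zpow g m <=o x ^+ n -> (m%:~R / n%:R <= slope x)%R.
Proof.
move=> /arch_floor[k [_ kx]] n0 xm; apply: ub_le_sup; last by exists m, n.
by exists ((k + 1)%:~R / 1%:R)%R; apply: slopes_ub; rewrite ?expg1.
Qed.

Lemma slope_gt0 : (0 < slope g)%R.
Proof.
apply: (@lt_le_trans _ _ (1%:~R / 1%:R)%R); first by rewrite divr1 ltr01.
by apply: slope_ge => //; [exact: arch_hull_gen|left; rewrite zpow1 expg1].
Qed.

Lemma slope_ge0 x : arch_hull x -> 1 <=o x -> (0 <= slope x)%R.
Proof.
move=> Lx x1; have -> : (0 = 0%:~R / 1%:R :> R)%R by rewrite mul0r.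
exact: slope_ge.
Qed.

End Holder.

(** When [x * y] is at most [y * x], moving a factor [y] to the left past a factor [x] can only
    increase a word, so the two sorted words are the extremes. *)
Lemma exp_mul_le (G : groupType) (lt : G -> G -> Prop) (x y : G) (n : nat) :
  group_order lt -> le lt (x * y) (y * x) ->
  le lt (x ^+ n * y ^+ n) ((x * y) ^+ n) /\
  le lt ((x * y) ^+ n) (y ^+ n * x ^+ n).
Proof.
move=> ltO xy.
have xny k : le lt (x ^+ k * y) (y * x ^+ k).
  elim: k => [|k IHk]; first by rewrite mul1g mulg1; left.
  rewrite expgSr -mulgA; apply: (leo_trans ltO (leo_mul2l ltO _ xy)).
  by rewrite !mulgA; apply: leo_mul2r.
elim: n => [|n [IH1 IH2]]; first by rewrite !mulg1; split; left.
split.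
  rewrite (expgS x) (expgS y) expgS.
  apply: (leo_trans ltO) (leo_mul2l ltO (x * y) IH1).
  rewrite !mulgA; apply: leo_mul2r => //; rewrite -!mulgA.
  by apply: leo_mul2l.
rewrite (expgSr y) (expgSr x) expgSr.
apply: (leo_trans ltO) (leo_mul2r ltO (x * y) IH2) _.
rewrite -!mulgA; apply: leo_mul2l => //.
by rewrite mulgA -expgSr; apply: xny.
Qed.

(** * Additivity of the slope *)

Section HolderMorphism.
Variables (R : realType) (G : groupType) (lt : G -> G -> Prop).
Hypothesis lt_ord : group_order lt.
Variable g : G.
Hypothesis g_gt1 : lt 1 g.
Local Notation "x <=o y" := (le lt x y) (at level 70).

(** If [y * x] is the smaller product, the bracket of [exp_mul_le] is applied to the reversed order.
    Commutation of the bounds makes them serve for either sorted word. *)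
Lemma exp_mul_bounds (x y u v u' v' : G) (n : nat) :
  u <=o x ^+ n -> v <=o y ^+ n -> x ^+ n <=o u' -> y ^+ n <=o v' ->
  commute u v -> commute u' v' ->
  u * v <=o (x * y) ^+ n /\ (x * y) ^+ n <=o u' * v'.
Proof.
move=> ux vy xu yv uv uv'.
case: (leo_total lt_ord (x * y) (y * x)) => [xy|].
  have [lo hi] := exp_mul_le n lt_ord xy; split.
    by apply: (leo_trans lt_ord) lo; apply: leo_mul.
  by apply: (leo_trans lt_ord hi); rewrite uv'; apply: leo_mul.
move=> yx; have xy : le (fun x y => lt y x) (x * y) (y * x).
  by case: yx => [->|]; [left|right].
have [hi lo] := exp_mul_le n (flip_group_order lt_ord) xy.
have flipE s t : le (fun x y => lt y x) s t -> t <=o s.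
  by move=> [->|]; [left|right].
split.
  by apply: (leo_trans lt_ord) (flipE _ _ lo); rewrite uv; apply: leo_mul.
by apply: (leo_trans lt_ord (flipE _ _ hi)); apply: leo_mul.
Qed.

Lemma commute_zpow (z : G) (m n : int) : commute (zpow z m) (zpow z n).
Proof. by rewrite /commute -!zpowD addrC. Qed.

(* [x ^+ n * y ^+ n] and [y ^+ n * x ^+ n] bracket [(x * y) ^+ n], so additivity
   does not require the archimedean factor to be known to be abelian. *)
Lemma slopeM (x y : G) : arch_hull lt g x -> arch_hull lt g y ->
  slope R lt g (x * y) = (slope R lt g x + slope R lt g y)%R.
Proof.
move=> Lx Ly; have sL := arch_hull_subgroup lt_ord g.
have Lxy := subgroupM sL Lx Ly.
set s := slope R lt g.
(* With [k] and [l] the floors of the powers [n.+1] of [x] and [y], both [s (x * y)] and [s x + s y]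
   lie between [(k + l) / n.+1] and [(k + l + 2) / n.+1]. *)
have close (n : nat) : (`|s (x * y)%g - (s x + s y)| * n.+1%:R <= 2%:R :> R)%R.
  have [k [k1 k2]] := arch_floor lt_ord g_gt1 (subgroupX n.+1 sL Lx).
  have [l [l1 l2]] := arch_floor lt_ord g_gt1 (subgroupX n.+1 sL Ly).
  have [lo hi] := exp_mul_bounds k1 l1 k2 l2 (commute_zpow _ _ _) (commute_zpow _ _ _).
  rewrite -!zpowD in lo hi.
  have := slope_ge R lt_ord g_gt1 Lx (ltn0Sn n) k1.
  have := slope_ge R lt_ord g_gt1 Ly (ltn0Sn n) l1.
  have := slope_ge R lt_ord g_gt1 Lxy (ltn0Sn n) lo.
  have := slope_le R lt_ord g_gt1 Lx (ltn0Sn n) k2.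
  have := slope_le R lt_ord g_gt1 Ly (ltn0Sn n) l2.
  have := slope_le R lt_ord g_gt1 Lxy (ltn0Sn n) hi.
  rewrite -/s !intrD !ler_pdivrMr ?ltr0Sn // !ler_pdivlMr ?ltr0Sn //.
  move: (s (x * y)%g) (s x) (s y) (n.+1%:R : R)%R (ltr0Sn R n) => u v w d d0.
  move=> *; rewrite -[d]gtr0_norm // -normrM ler_norml; apply/andP; split; lra.
apply/eqP; rewrite -subr_eq0 -normr_le0; apply/negPn/negP; rewrite -ltNge.
set e := (`|_|)%R => e0.
have [n ne] : exists n : nat, (2 / e < n%:R)%R.
  by exists (Num.bound (2 / e)); apply: archi_boundP; rewrite divr_ge0 // ltW.
have := close n; rewrite leNgt => /negP; apply.
rewrite mulrC -ltr_pdivrMr //; apply: lt_trans ne _.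
by rewrite ltr_nat.
Qed.

End HolderMorphism.

(** * Convex subgroups and jumps *)

Section RightOrder.
Variables (G : groupType) (lt : G -> G -> Prop).
Hypothesis lt_right : right_order lt.
Implicit Types (x y g : G) (H K L : set G).

Lemma rlt_pos x y : lt x y <-> lt 1 (y / x).
Proof.
case: lt_right => _ mul_r; split=> xy.
  by rewrite -(mulgV x); apply: mul_r.
by rewrite -[x]mul1g -[y](mulgVK x); apply: mul_r.
Qed.

Lemma rlt1V x : x <> 1 -> lt 1 x \/ lt 1 x^-1.
Proof.
case: lt_right => -[_ _ tot] _ x1; case: (tot 1 x) => [|/esym//|]; first by left.
by move/rlt_pos; rewrite div1g; right.
Qed.

Lemma convex_mem H x y : convex_subgroups lt H -> H y -> lt 1 x -> lt x y -> H x.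
Proof. by move=> [sH cH] Hy; apply: cH Hy; apply: subgroup1. Qed.

Lemma not_subset_pos H K : subgroup H -> subgroup K -> ~ H `<=` K ->
  exists h, [/\ H h, ~ K h & lt 1 h].
Proof.
move=> sH sK /existsNP[h /not_implyP[Hh Kh]].
have [|h1|h1] := @rlt1V h; first by move=> h1; apply: Kh; rewrite h1; apply: subgroup1.
  by exists h.
by exists h^-1; split=> //; [exact: subgroupV|move/(subgroupVE sK)].
Qed.

Lemma convex_subgroups_total :
  total_on (convex_subgroups lt) (fun H K => H `<=` K).
Proof.
move=> H K cH cK; apply: contrapT => /not_orP[].
move=> /(not_subset_pos cH.1 cK.1)[h [Hh Kh h1]].
move=> /(not_subset_pos cK.1 cH.1)[k [Kk Hk k1]].
case: lt_right => -[_ _ tot] _; case: (tot h k) => [hk|hk|kh].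
- by apply: Kh; apply: convex_mem hk.
- by apply: Kh; rewrite hk.
- by apply: Hk; apply: convex_mem kh.
Qed.

Lemma convex_set1 : convex_subgroups lt [set 1].
Proof.
split; first exact: subgroup_set1.
case: lt_right => -[irr tr _] _ x y z /= -> -> y1 /(tr _ _ _ y1) /irr [].
Qed.

Lemma convex_setT : convex_subgroups lt setT.
Proof. by split; [exact: subgroup_setT|]. Qed.

Lemma convex_bigcap (T : set (set G)) : T `<=` convex_subgroups lt ->
  convex_subgroups lt (\bigcap_(H in T) H).
Proof.
move=> Tc; split.
  split=> [H /Tc[/subgroup1//]|x y Hx Hy H TH].
  by case: (Tc H TH) => -[_ HB] _; apply: HB; [apply: Hx|apply: Hy].
move=> x y z Hx Hz xy yz H TH.
by case: (Tc H TH) => _; apply; [apply: Hx|apply: Hz|exact: xy|exact: yz].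
Qed.

Lemma convex_bigcup (T : set (set G)) : T `<=` convex_subgroups lt ->
  T !=set0 -> convex_subgroups lt (\bigcup_(H in T) H).
Proof.
move=> Tc [H0 TH0].
have dir H K : T H -> T K -> exists2 M, T M & H `<=` M /\ K `<=` M.
  move=> TH TK; case: (convex_subgroups_total (Tc _ TH) (Tc _ TK)) => HK.
    by exists K => //; split.
  by exists H => //; split.
split.
  split; first by exists H0 => //; apply: subgroup1; case: (Tc _ TH0).
  move=> x y [H TH Hx] [K TK Ky]; have [M TM [HM KM]] := dir _ _ TH TK.
  exists M => //; case: (Tc _ TM) => -[_ MB] _.
  by apply: MB; [apply: HM|apply: KM].
move=> x y z [H TH Hx] [K TK Kz] xy yz; have [M TM [HM KM]] := dir _ _ TH TK.
exists M => //; case: (Tc _ TM) => _ cM.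
exact: (cM x y z (HM _ Hx) (KM _ Kz)).
Qed.

Lemma jump_lower_convex g : g <> 1 -> convex_subgroups lt (jump_lower lt g).
Proof.
move=> g1; apply: convex_bigcup => [H []//|].
by exists [set 1]; split; [exact: convex_set1|].
Qed.

Lemma jump_upper_convex g : convex_subgroups lt (jump_upper lt g).
Proof. by apply: convex_bigcap => H []. Qed.

Lemma jump_lowerN g : ~ jump_lower lt g g.
Proof. by move=> [H [_ Hg]]. Qed.

Lemma jump_upper_gen g : jump_upper lt g g.
Proof. by move=> H []. Qed.

Lemma jump_lower_max H g : convex_subgroups lt H -> ~ H g ->
  H `<=` jump_lower lt g.
Proof. by move=> cH Hg x Hx; exists H. Qed.

Lemma jump_upper_min H g : convex_subgroups lt H -> H g ->
  jump_upper lt g `<=` H.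
Proof. by move=> cH Hg x; apply. Qed.

(** A convex subgroup either contains [g], hence the upper group, or misses [g], hence lies in the
    lower one. *)
Lemma jump_convex_jump g : g <> 1 ->
  convex_jump lt (jump_lower lt g) (jump_upper lt g).
Proof.
move=> g1; have cC := jump_lower_convex g1; have cD := jump_upper_convex g.
split=> //.
  split; last by move=> DC; exact: (@jump_lowerN g (DC _ (@jump_upper_gen g))).
  case: (convex_subgroups_total cC cD) => // DC.
  by case: (@jump_lowerN g (DC _ (@jump_upper_gen g))).
move=> X cX [[_ CX] [_ XD]]; case: (pselect (X g)) => Xg.
  by apply: XD; apply: jump_upper_min.
by apply: CX; apply: jump_lower_max.
Qed.

Lemma jump_lowerV g : jump_lower lt g^-1 = jump_lower lt g.
Proof.
apply/seteqP; split=> x [H [cH Hg] Hx]; exists H => //; split=> // /subgroupV.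
  by move/(_ cH.1)/Hg.
by rewrite invgK => /(_ cH.1)/Hg.
Qed.

Lemma jump_upperV g : jump_upper lt g^-1 = jump_upper lt g.
Proof.
apply/seteqP; split=> x Hx H [cH Hg]; apply: Hx; split=> //.
  by apply: subgroupV Hg; case: cH.
by apply: subgroupVE Hg; case: cH.
Qed.

End RightOrder.

(** * Monotone real characters on subgroups *)

Section Morphisms.
Variables (R : realType) (G : groupType).
Implicit Types (L : set G) (phi : G -> R) (x y : G).

Definition hom_on L phi : Prop :=
  forall x y, L x -> L y -> phi (x * y) = (phi x + phi y)%R.

Variables (L : set G) (phi : G -> R).
Hypotheses (sL : subgroup L) (phiM : hom_on L phi).

Lemma hom_on1 : phi 1 = 0%R.
Proof.
have := phiM (subgroup1 sL) (subgroup1 sL); rewrite mulg1 => /eqP.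
by rewrite -subr_eq0 opprD addNKr oppr_eq0 => /eqP.
Qed.

Lemma hom_onV x : L x -> phi x^-1 = (- phi x)%R.
Proof.
move=> Lx; apply/eqP; rewrite -addr_eq0 -phiM //; last exact: subgroupV.
by rewrite mulVg hom_on1.
Qed.

Lemma hom_onB x y : L x -> L y -> phi (x / y) = (phi x - phi y)%R.
Proof. by move=> Lx Ly; rewrite phiM ?hom_onV //; apply: subgroupV. Qed.

Lemma hom_onX x n : L x -> phi (x ^+ n) = (n%:R * phi x)%R.
Proof.
move=> Lx; elim: n => [|n IHn]; first by rewrite hom_on1 mul0r.
rewrite expgS phiM //; last exact: subgroupX.
by rewrite IHn -add1n natrD mulrDl mul1r.
Qed.

Lemma hom_on_zpow x m : L x -> phi (zpow x m) = (m%:~R * phi x)%R.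
Proof.
move=> Lx; case: m => n; first exact: hom_onX.
rewrite /= hom_onV ?hom_onX //; last exact: subgroupX.
by rewrite NegzE mulrNz mulNr.
Qed.

Lemma hom_onJ x y : L x -> L y -> phi (x ^ y) = phi x.
Proof.
move=> Lx Ly; have LV := subgroupV sL Ly.
rewrite conjgE !phiM ?hom_onV //; last exact: subgroupM.
by rewrite addrC addrK.
Qed.

Lemma ker_subgroup : subgroup [set x | L x /\ phi x = 0%R].
Proof.
split; first by split; [exact: subgroup1|exact: hom_on1].
move=> x y [Lx x0] [Ly y0]; split; first by apply: sL.2.
by rewrite hom_onB // x0 y0 subr0.
Qed.

Variable lt : G -> G -> Prop.
Hypothesis lt_right : right_order lt.
Hypothesis phi_ge0 : forall x, L x -> lt 1 x -> (0 <= phi x)%R.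

Lemma hom_on_le x y : L x -> L y -> lt x y -> (phi x <= phi y)%R.
Proof.
move=> Lx Ly /(rlt_pos lt_right) xy; rewrite -subr_ge0 -hom_onB //.
by apply: phi_ge0 => //; apply: sL.2.
Qed.

Lemma hom_on_lt x y : L x -> L y -> (phi x < phi y)%R -> lt x y.
Proof.
move=> Lx Ly xy; case: lt_right => -[_ _ tot] _.
case: (tot x y) => // [exy|/(hom_on_le Ly Lx)].
  by move: xy; rewrite exy ltxx.
by rewrite leNgt xy.
Qed.

Lemma ker_convex : convex lt L -> convex_subgroups lt [set x | L x /\ phi x = 0%R].
Proof.
move=> cL; split; first exact: ker_subgroup.
move=> x y z [Lx x0] [Lz z0] xy yz.
have Ly : L y by apply: (cL x y z).
split=> //; apply/eqP; rewrite eq_le -{1}z0 -x0.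
by rewrite !hom_on_le.
Qed.

(** Some element of [H] has positive value, so by the Archimedean property of the reals its powers
    bracket [g]. Thus a convex subgroup on which the character is not trivial cannot miss any
    element of [L]. *)
Lemma hom_on_arch (H : set G) x g : convex_subgroups lt H ->
  H x -> L x -> L g -> phi x <> 0%R -> H g.
Proof.
move=> [sH cH] Hx Lx Lg x0.
have [y [Hy Ly y0]] : exists y, [/\ H y, L y & (0 < phi y)%R].
  case: (ltgtP (phi x) 0%R) => // x_sgn; last by exists x.
  by exists x^-1; rewrite hom_onV // oppr_gt0; split=> //; apply: subgroupV.
have [n ng] : exists n : nat, (`|phi g| < n%:R * phi y)%R.
  exists (Num.bound (`|phi g| / phi y)); rewrite -ltr_pdivrMr //.
  by apply: archi_boundP; rewrite divr_ge0 // ltW.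
have Hyn := subgroupX n sH Hy; have Lyn := subgroupX n sL Ly.
move: ng; rewrite ltr_norml => /andP[ng gn].
apply: (cH (y ^- n) g (y ^+ n)) => //; first exact: subgroupV.
  by apply: hom_on_lt; rewrite ?hom_onV ?hom_onX //; apply: subgroupV.
by apply: hom_on_lt; rewrite ?hom_onX.
Qed.

End Morphisms.

(** * The character of a convex jump *)

Section Jump.
Variables (R : realType) (G : groupType) (lt : G -> G -> Prop).
Hypothesis lt_ord : group_order lt.

(** The character is the slope with base [g]. Its kernel is convex and misses [g], so it lies in the
    lower group; conversely the lower group lies in the kernel, since otherwise [hom_on_arch] would
    put [g] into it. *)
Lemma jump_hom g : g <> 1 -> exists phi : G -> R,
  [/\ hom_on (jump_upper lt g) phi,
      forall x, jump_upper lt g x -> lt 1 x -> (0 <= phi x)%R &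
      forall x, jump_lower lt g x <-> jump_upper lt g x /\ phi x = 0%R].
Proof.
have rO := lt_ord.1.
(* The slope needs a positive base, and [g] and [g^-1] determine the same jump. *)
wlog g1 : g / lt 1 g => [wl gn1|_].
  case: (rlt1V rO gn1) => [/wl/(_ gn1)//|/wl].
  rewrite jump_lowerV jump_upperV; apply=> gV1.
  by apply: gn1; rewrite -[g]invgK gV1 invg1.
have gn1 : g <> 1 by move=> e; apply: (@lto_irr _ _ lt_ord 1); rewrite -{2}e.
set D := jump_upper lt g; set C := jump_lower lt g.
have [_ _ [CD _] _] := jump_convex_jump rO gn1; rewrite -/C -/D in CD.
have sL := arch_hull_subgroup lt_ord g; set L := arch_hull lt g in sL.
have DL : D = L.
  apply/seteqP; split.
    apply: jump_upper_min; last exact: arch_hull_gen.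
    by split=> //; exact: arch_hull_convex.
  move=> x [n [nx xn]] H [[sH cH] Hg].
  have Hz m : H (zpow g m) by apply: subgroup_zpow.
  case: nx => [<-//|nx]; case: xn => [->//|xn].
  exact: cH nx xn.
have phiM : hom_on D (slope R lt g) by rewrite DL => x y Lx Ly; apply: slopeM.
have phi0 x : D x -> lt 1 x -> (0 <= slope R lt g x)%R.
  by rewrite DL => Lx x1; apply: slope_ge0 => //; right.
have cD : convex_subgroups lt D := jump_upper_convex lt g.
have Dg : D g := @jump_upper_gen _ lt g.
have phig := slope_gt0 R lt_ord g1.
exists (slope R lt g); split=> // x; split=> [Cx|].
  split; first exact: CD.
  apply: contrapT => x0; case: (@jump_lowerN _ lt g).
  apply: (hom_on_arch cD.1 phiM rO phi0 (jump_lower_convex rO gn1) Cx) => //.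
  exact: CD.
move=> Dx; apply: (@jump_lower_max _ lt _ g (ker_convex cD.1 phiM rO phi0 cD.2)) => //.
by move=> [_ g0]; rewrite g0 ltxx in phig.
Qed.

End Jump.

(** * Positive cones and their lexicographic extensions *)

Section Cones.
Variables (R : realType) (G : groupType).
Implicit Types (K L V : set G) (x y g : G).

(** The elements at or above 1 for a right-invariant total preorder on [K], where [x] is below [y]
    when [y / x] is in [V]. The units, that is the [x] with both [x] and [x^-1] in [V], form a
    subgroup, and the preorder is a total order on its right cosets. *)
Definition cone K V : Prop :=
  [/\ subgroup K, V `<=` K, forall x y, V x -> V y -> V (x * y) &
      forall x, K x -> V x \/ V x^-1].

(** Every [g] strictly above 1 lies in a convex subgroup with a monotone character positive at [g].
    The clause on [y * x] is convexity, as [x] lies between 1 and [y * x]. Being stated element by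
    element, the property passes to lexicographic extensions. *)
Definition archimedean_cone K V : Prop :=
  forall g, V g -> ~ V g^-1 -> exists L (phi : G -> R),
    [/\ [/\ subgroup L, L `<=` K & L g],
        forall x y, V x -> V y -> L (y * x) -> L x,
        hom_on L phi,
        forall x, L x -> V x -> (0 <= phi x)%R &
        (0 < phi g)%R].

Lemma hom_cone K (phi : G -> R) : subgroup K -> hom_on K phi ->
  cone K [set x | K x /\ (0 <= phi x)%R].
Proof.
move=> sK phiM; split=> // [x []//|x y [Kx x0] [Ky y0]|x Kx].
  by split; [apply: subgroupM|rewrite phiM // addr_ge0].
case: (leP 0%R (phi x)) => x0; [by left|right; split; first exact: subgroupV].
by rewrite (hom_onV sK phiM) // oppr_ge0 ltW.
Qed.

Lemma hom_cone_archimedean K (phi : G -> R) : subgroup K -> hom_on K phi ->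
  archimedean_cone K [set x | K x /\ (0 <= phi x)%R].
Proof.
move=> sK phiM g [Kg g0] gV; exists K, phi; split=> // [|x y []//|x _ []//|].
  by split.
rewrite lt_neqAle g0 andbT; apply/eqP => /esym g0'; apply: gV.
by split; [exact: subgroupV|rewrite (hom_onV sK phiM) // g0' oppr0].
Qed.

(* The positive elements of the lexicographic extension of [V1] by [V2] when
   the units of [V2] are the domain of [V1]. *)
Definition cone_ext V2 V1 : set G := [set x | V2 x /\ (V2 x^-1 -> V1 x)].

Section Extension.
Variables (K L V1 V2 : set G).
Hypotheses (cone1 : cone K V1) (cone2 : cone L V2).
Hypothesis units2 : forall x, K x <-> V2 x /\ V2 x^-1.

Lemma units_mul V x y : (forall x y, V x -> V y -> V (x * y)) ->
  V x -> V y -> V (x * y)^-1 -> V x^-1 /\ V y^-1.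
Proof.
move=> VM Vx Vy VV; split.
  by rewrite -(mulVKg y x^-1) -invgM; apply: VM.
by rewrite -(mulgVK x y^-1) -invgM; apply: VM.
Qed.

Lemma cone_ext_cone : cone L (cone_ext V2 V1).
Proof.
case: cone1 cone2 => sK V1K V1M V1t [sL V2L V2M V2t].
split=> // [x [/V2L]//|x y [V2x x1] [V2y y1]|x Lx].
  split; first exact: V2M.
  by move=> /(units_mul V2M V2x V2y)[/x1 V1x /y1 V1y]; apply: V1M.
rewrite /cone_ext /= invgK.
case: (pselect (V2 x)) => V2x; case: (pselect (V2 x^-1)) => V2xV; last first.
- by case: (V2t x Lx).
- by right.
- by left.
by case: (V1t x) => [|V1x|V1x]; [apply/units2|left|right].
Qed.

(** The units of the extension are those of the lower cone, so extensions can be iterated down a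
    chain of subgroups. *)
Lemma cone_ext_units x :
  (cone_ext V2 V1 x /\ cone_ext V2 V1 x^-1) <-> (V1 x /\ V1 x^-1).
Proof.
case: cone1 => sK V1K _ _; rewrite /cone_ext /= invgK.
split=> [[[V2x x1] [V2xV xV1]]|[V1x V1xV]].
  by split; [apply: x1|apply: xV1].
by have [V2x V2xV] := (units2 x).1 (V1K _ V1x).
Qed.

(** This is the convexity of [K]: if a product of two elements of the cone [V2] is a unit, so are
    its factors, and then [V1] decides. *)
Lemma cone_ext_mem x y :
  cone_ext V2 V1 x -> cone_ext V2 V1 y -> K (y * x) -> V1 x /\ V1 y.
Proof.
case: cone2 => _ _ V2M _ [V2x x1] [V2y y1] /units2[_].
by move=> /(units_mul V2M V2y V2x)[/y1 ? /x1 ?].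
Qed.

Lemma cone_ext_archimedean : archimedean_cone K V1 -> archimedean_cone L V2 ->
  archimedean_cone L (cone_ext V2 V1).
Proof.
case: cone1 cone2 => sK V1K _ _ [sL V2L V2M _] arch1 arch2 g [V2g g1] gV.
have KL : K `<=` L by move=> x /units2[/V2L].
(* If [g] is a unit of [V2], the lower cone supplies the subgroup and the character; otherwise the
   upper cone does. *)
case: (pselect (V2 g^-1)) => V2gV.
  have V1g := g1 V2gV.
  have [|M [phi [[sM MK Mg] Mconv phiM phi0 phig]]] := arch1 g V1g.
    by move=> V1gV; apply: gV; split.
  exists M, phi; split=> // [|x y Vx Vy Myx|x Mx [_ x1]].
  - by split=> // x /MK/KL.
  - have [V1x V1y] := cone_ext_mem Vx Vy (MK _ Myx).
    exact: Mconv Myx.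
  - by apply: phi0 => //; apply: x1; case: (units2 x).1 => //; apply: MK.
have [M [phi [Mg Mconv phiM phi0 phig]]] := arch2 g V2g V2gV.
by exists M, phi; split=> // [x y [V2x _] [V2y _]|x Mx [V2x _]];
  [apply: Mconv|apply: phi0].
Qed.

End Extension.

(** * The right order of a cone with trivial units *)

Section ConeOrder.
Variable V : set G.
Hypotheses (coneV : cone setT V) (units1 : forall x, V x -> V x^-1 -> x = 1).

Definition cone_order x y : Prop := x <> y /\ V (y / x).

Lemma cone_order_right : right_order cone_order.
Proof.
case: coneV => _ _ VM Vt; split; last first.
  by move=> f g h [fg Vgf]; split; [move/mulIg|rewrite mulgKA].
split=> [x []//|x y z [xy Vyx] [yz Vzy]|x y].
  split; last by rewrite -(divgKA y z x^-1); apply: VM.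
  move=> xz; apply: xy; apply/esym/divg1_eq/units1 => //.
  by rewrite invgF xz.
case: (pselect (x = y)) => xy; first by constructor 2.
case: (Vt (y / x)) => // [Vyx|]; first by constructor 1.
by rewrite invgF; constructor 3; split=> // /esym.
Qed.

Lemma cone_order_gt1 x : cone_order 1 x <-> V x /\ x <> 1.
Proof.
by rewrite /cone_order divg1; split=> -[H1 H2]; split=> // /esym.
Qed.

Hypothesis archV : archimedean_cone setT V.

(** A positive [g] in [K] outside [H] has a convex [L] and a character [phi] from [archV]. Then [L]
    contains [K], and the kernel of [phi] on [K] is a convex subgroup containing [H] but not [g]; by
    the jump property it equals [H]. *)
Lemma cone_order_jump H K : convex_jump cone_order H K ->
  exists phi : G -> R, [/\ hom_on K phi,
    forall x, K x -> cone_order 1 x -> (0 <= phi x)%R &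
    forall x, H x <-> K x /\ phi x = 0%R].
Proof.
have rO := cone_order_right.
move=> [cH cK [HK KH] HKmin].
have [g [Kg Hg /cone_order_gt1[Vg g1]]] := not_subset_pos rO cK.1 cH.1 KH.
have gV : ~ V g^-1 by move=> /(units1 Vg).
have [L [phi [[sL _ Lg] Lconv phiM phi0 phig]]] := archV Vg gV.
have cL : convex_subgroups cone_order L.
  split=> // x y z Lx Lz [_ Vyx] [_ Vzy].
  apply: (subgroupMr sL (y := x^-1)); first exact: subgroupV.
  by apply: (Lconv _ _ Vyx Vzy); rewrite divgKA; apply: sL.2.
have KL : K `<=` L.
  case: (convex_subgroups_total rO cK cL) => // LK.
  apply: contrapT => KL; apply: (HKmin L cL); split; split=> //.
    case: (convex_subgroups_total rO cH cL) => // LH.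
    by case: Hg; apply: LH.
  by move=> LH; apply/Hg/LH.
have phiMK : hom_on K phi by move=> x y /KL ? /KL ?; apply: phiM.
have phi0K x : K x -> cone_order 1 x -> (0 <= phi x)%R.
  by move=> /KL Lx /cone_order_gt1[Vx _]; apply: phi0.
have cE := ker_convex cK.1 phiMK rO phi0K cK.2.
have HE : H `<=` [set x | K x /\ phi x = 0%R].
  move=> x Hx; split; first exact: HK.
  apply: contrapT => x0; apply: Hg.
  by apply: (hom_on_arch cK.1 phiMK rO phi0K cH Hx _ Kg x0); apply: HK.
exists phi; split=> // x; split=> [/HE//|].
apply: contraPP => Hx Ex; apply: (HKmin _ cE); split; split=> //.
- by move=> EH; apply/Hx/EH.
- by move=> y [].
- by move=> /(_ _ Kg)[_ g0]; rewrite g0 ltxx in phig.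
Qed.

Lemma coset_mem (H : set G) x : subgroup H -> set_mul H [set x] x.
Proof. by move=> sH; exists 1; [exact: subgroup1|exists x; rewrite ?mul1g]. Qed.

(** Cosets are the fibres of the character, so products and comparisons of cosets can be read off
    from its values. *)
Lemma coset_eq_hom (H K : set G) (phi : G -> R) : subgroup K -> hom_on K phi ->
  (forall x, H x <-> K x /\ phi x = 0%R) -> forall x, K x ->
  set_mul H [set x] = [set y | K y /\ phi y = phi x].
Proof.
move=> sK phiM HE x Kx; apply/seteqP; split=> [_ [h /HE[Kh h0] [_ -> <-]]|y [Ky yx]].
  by split; [exact: subgroupM|rewrite phiM // h0 add0r].
exists (y / x); last by exists x; rewrite ?mulgVK.
by apply/HE; split; [apply: sK.2|rewrite (hom_onB sK phiM) // yx subrr].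
Qed.

Lemma cone_order_lexicographic : lexicographic R cone_order.
Proof.
have rO := cone_order_right.
split.
  split.
  - by split; [move=> H []|exact: convex_subgroups_total].
  - by split; [exact: convex_set1|exact: convex_setT].
  - by move=> T TS T0; split; [exact: convex_bigcup|exact: convex_bigcap].
  move=> H K jump; have [phi [phiM _ HE]] := cone_order_jump jump.
  have [[sH _] [sK _] [HK _] _] := jump.
  split=> // h k /HE[Kh h0] Kk; apply/HE; rewrite (hom_onJ sK phiM) //.
  split=> //; rewrite conjgE; apply: subgroupM => //; first exact: subgroupV.
  exact: subgroupM.
move=> H K jump; have [phi [phiM phi0 HE]] := cone_order_jump jump.
have [[sH _] [sK _] [HK _] _] := jump.
have cosetE := coset_eq_hom sK phiM HE.
(* [Phi] evaluates [phi] at a chosen representative; cosets are nonempty, so the default 1 is never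
   taken on them. *)
pose Phi (A : set G) := phi (xget 1 A).
have PhiE x : K x -> Phi (set_mul H [set x]) = phi x.
  move=> Kx; have : set_mul H [set x] (xget 1 (set_mul H [set x])).
    by apply: xgetPex; exists x; apply: coset_mem.
  by rewrite {1}cosetE // => -[].
exists Phi => _ _ [x Kx <-] [y Ky <-].
have Kxy := subgroupM sK Kx Ky.
split.
  suff -> : set_mul (set_mul H [set x]) (set_mul H [set y]) =
            set_mul H [set x * y] by rewrite !PhiE // phiM.
  rewrite !cosetE //; apply/seteqP; split.
    move=> _ [u [Ku ux] [v [Kv vy] <-]].
    by split; [exact: subgroupM|rewrite !phiM // ux vy].
  move=> z [Kz zxy]; exists x => //; exists (x^-1 * z); last by rewrite mulVKg.
  have KV := subgroupV sK Kx.
  split; first exact: subgroupM.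
  by rewrite phiM // (hom_onV sK phiM) // zxy phiM // addKr.
rewrite !PhiE //; split.
  rewrite !cosetE // => -[xy [u [v [[Ku ux] [Kv vy] uv]]]].
  rewrite -ux -vy lt_neqAle (hom_on_le sK phiM rO phi0 Ku Kv uv) andbT.
  by apply/eqP => e; apply: xy; rewrite -ux -vy e.
move=> xy; split.
  by move=> e; move: xy; rewrite -PhiE // e PhiE // ltxx.
exists x, y; split; [exact: coset_mem|exact: coset_mem|].
exact: (hom_on_lt sK phiM rO phi0 Kx Ky xy).
Qed.

End ConeOrder.
End Cones.

Lemma sub_generated (G : groupType) (X : set G) : X `<=` generated X.
Proof. by move=> x Xx M [_]; apply. Qed.

(** * The discrete order *)

(* [theta] is the projection along the rationals onto a maximal Q-linear set [M]
   without nonzero rationals. *)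
Lemma additive_kernel_rat (R : realType) : exists theta : R -> R,
  (forall x y, theta (x + y)%R = (theta x + theta y)%R) /\
  (forall x, theta x = 0%R <-> exists q : rat, x = ratr q).
Proof.
pose lin (M : set R) := forall (p q : rat) x y,
  M x -> M y -> M (ratr p * x + ratr q * y)%R.
pose P (M : set R) := lin M /\ forall q : rat, M (ratr q) -> q = 0%R.
have [F FP totF|M [[Mlin Mrat] Mmax]] := @Zorn_bigcup R P.
  split; last by move=> q [X /FP[_]]; apply.
  move=> p q x y [X FX Xx] [Y FY Yy].
  case: (totF X Y FX FY) => XY; [exists Y => //|exists X => //].
    by apply: (FP _ FY).1 => //; apply: XY.
  by apply: (FP _ FX).1 => //; apply: XY.
(* [lin] admits the empty set, because the union of the empty chain must satisfy [P]. Adding zero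
   makes [M0] a Q-linear subspace. *)
pose M0 (x : R) := M x \/ x = 0%R.
have M0lin : lin M0.
  move=> p q x y [Mx|->] [My|->]; rewrite ?mulr0; last by rewrite addr0; right.
  - by left; apply: Mlin.
  - by left; rewrite -[0%R](mul0r x) -[X in (X * x)%R](rmorph0 (@ratr R)); apply: Mlin.
  - by left; rewrite -[0%R](mul0r y) -[X in (X * y)%R](rmorph0 (@ratr R)); apply: Mlin.
have M0rat q : M0 (ratr q) -> q = 0%R.
  by move=> [/Mrat//|/eqP]; rewrite fmorph_eq0 => /eqP.
have dec x : exists m, M0 m /\ exists q : rat, x = (ratr q + m)%R.
  case: (pselect (M x)) => Mx.
    by exists x; split; [left|exists 0%R; rewrite rmorph0 add0r].
  (* If [x] is not in [M], the span of [M0] and [x] is strictly larger than [M], so by maximality it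
     contains a nonzero rational [m + q x]. Here [q] is nonzero, and solving for [x] gives the
     decomposition. *)
  pose M' := [set u : R | exists m (q : rat), M0 m /\ u = (m + ratr q * x)%R].
  have M'lin : lin M'.
    move=> p q _ _ [m [r [Mm ->]]] [n [s [Mn ->]]].
    exists (ratr p * m + ratr q * n)%R, (p * r + q * s)%R; split.
      exact: M0lin.
    by rewrite rmorphD !rmorphM /=; ring.
  have : ~ P M'.
    apply: Mmax; split=> [m Mm|M'M].
      by exists m, 0%R; split; [left|rewrite rmorph0 mul0r addr0].
    apply: Mx; apply: M'M; exists 0%R, 1%R.
    by split; [right|rewrite rmorph1 mul1r add0r].
  move=> /not_andP[//|/existsNP[r /not_implyP[[m [q [Mm rmq]]] r0]]].
  have q0 : q != 0%R.
    apply/eqP => q0; apply/r0/M0rat.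
    by rewrite rmq q0 rmorph0 mul0r addr0.
  have q0' : ratr q != 0%R :> R by rewrite fmorph_eq0.
  exists (ratr (- q^-1) * m + ratr 0 * m)%R; split; first exact: M0lin.
  exists (r / q)%R; rewrite rmorph0 rmorphN fmorph_div fmorphV /= rmq.
  by field.
have [theta thetaP] := choice dec.
have uniq m n (q r : rat) : M0 m -> M0 n -> (ratr q + m = ratr r + n)%R ->
    q = r /\ m = n.
  move=> Mm Mn e; have e' : (ratr (r - q) = ratr 1 * m + ratr (- 1) * n :> R)%R.
    by rewrite rmorphB rmorphN rmorph1 /=; lra.
  have rq : (r - q = 0)%R by apply: M0rat; rewrite e'; apply: M0lin.
  have qr : q = r by apply/esym/eqP; rewrite -subr_eq0 rq.
  by split=> //; apply: (addrI (ratr q)); rewrite e qr.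
exists theta; split=> [x y|x].
  have [Mx [q xq]] := thetaP x; have [My [r yr]] := thetaP y.
  have [Mxy [s xys]] := thetaP (x + y)%R.
  have Ms : M0 (theta x + theta y)%R.
    by rewrite -[theta x]mul1r -[theta y]mul1r -(rmorph1 (@ratr R)); apply: M0lin.
  apply: (uniq _ _ s (q + r)%R Mxy Ms _).2.
  by rewrite -xys rmorphD /= {1}xq {1}yr addrACA.
have [Mx [q xq]] := thetaP x; split=> [x0|[r xr]].
  by exists q; rewrite xq x0 addr0.
apply: (uniq _ _ q r Mx _ _).2; first by right.
by rewrite -xq xr addr0.
Qed.

(** * The cones along the chain from [Z] to [G] *)

Section Construction.
Variables (R : realType) (G : groupType) (lt : G -> G -> Prop) (a : G).
Hypotheses (lt_ord : group_order lt) (a_neq1 : a <> 1).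

Variables C D : set G.
Hypotheses (CE : C = jump_lower lt a) (DE : D = jump_upper lt a).
Local Notation Z := (cyclic_subgroup a).

Variable psi : G -> R.
Hypothesis psiM : hom_on D psi.
Hypothesis psi0 : forall x, C x <-> D x /\ psi x = 0%R.

Implicit Types (x y c : G) (m n : int).

Let cD : convex_subgroups lt D. Proof. by rewrite DE; apply: jump_upper_convex. Qed.
Let cC : convex_subgroups lt C.
Proof. by rewrite CE; exact: (jump_lower_convex lt_ord.1 a_neq1). Qed.
Let sD : subgroup D. Proof. exact: cD.1. Qed.
Let sC : subgroup C. Proof. exact: cC.1. Qed.
Let sZ : subgroup Z. Proof. exact: subgroup_cyclic. Qed.
Let Da : D a. Proof. by rewrite DE; apply: (@jump_upper_gen _ lt a). Qed.
Let Dz m : D (zpow a m). Proof. exact: (subgroup_zpow m sD Da). Qed.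
Let CD : C `<=` D. Proof. by move=> x /psi0[]. Qed.

Let psia : psi a != 0%R.
Proof.
by apply/eqP => a0; apply: (@jump_lowerN _ lt a); rewrite -CE; apply/psi0.
Qed.

(** The subgroup generated by [a] and [C], described through [psi]; [generated_root] identifies the
    two. *)
Definition root_subgroup : set G :=
  [set x | D x /\ exists m : int, psi x = (m%:~R * psi a)%R].
Local Notation A := root_subgroup.

Lemma root_subgroup_subgroup : subgroup A.
Proof.
split; first by split; [exact: subgroup1|exists 0%R; rewrite mul0r (hom_on1 sD psiM)].
move=> x y [Dx [m xm]] [Dy [n yn]]; split; first exact: sD.2.
by exists (m - n)%R; rewrite (hom_onB sD psiM) // xm yn intrB mulrBl.
Qed.

Lemma conj_jump_lower m c : C c -> C (c ^ zpow a m).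
Proof.
move=> /psi0[Dc c0]; apply/psi0; rewrite (hom_onJ sD psiM) //; split=> //.
rewrite conjgE; apply: subgroupM => //; first exact: subgroupV.
exact: subgroupM.
Qed.

Lemma root_subgroupP x : A x <-> exists m c, C c /\ x = zpow a m * c.
Proof.
split=> [[Dx [m xm]]|[m [c [/psi0[Dc c0] ->]]]].
  exists m, (zpow a (- m) * x); rewrite mulgA -zpowD subrr mul1g; split=> //.
  apply/psi0; split; first exact: subgroupM.
  by rewrite psiM // (hom_on_zpow sD psiM) // xm -mulrDl -intrD addNr mul0r.
split; first exact: subgroupM.
by exists m; rewrite psiM // c0 addr0 (hom_on_zpow sD psiM).
Qed.

(** [psi] vanishes on [C] but not at [a], so it recovers the exponent. Each right coset of [Z] in
    [A] thus has exactly one representative in [C]. *)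
Lemma root_decomp_uniq m n c d : C c -> C d ->
  zpow a m * c = zpow a n * d -> m = n /\ c = d.
Proof.
move=> /psi0[Dc c0] /psi0[Dd d0] e.
have : psi (zpow a m * c) = psi (zpow a n * d) by rewrite e.
rewrite !psiM // c0 d0 !addr0 !(hom_on_zpow sD psiM) //.
move/(mulIf psia)/intr_inj => mn; split=> //.
by move: e; rewrite mn => /mulgI.
Qed.

Lemma root_decompM m n c d :
  (zpow a m * c) * (zpow a n * d) = zpow a (m + n)%R * (c ^ zpow a n * d).
Proof. by rewrite zpowD conjgE !mulgA mulgK. Qed.

Lemma root_decompV m c :
  (zpow a m * c)^-1 = zpow a (- m) * c^-1 ^ zpow a (- m).
Proof. by rewrite -conjgC invgM zpowN. Qed.

Lemma generated_root : generated ([set a] `|` C) = A.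
Proof.
apply/seteqP; split=> x.
  apply; split; first exact: root_subgroup_subgroup.
  move=> y [->|Cy]; apply/root_subgroupP.
    by exists 1%R, 1; rewrite zpow1 mulg1; split=> //; apply: subgroup1.
  by exists 0%R, y; rewrite mul1g.
move=> /root_subgroupP[m [c [Cc ->]]] M [sM sub].
apply: subgroupM => //; last by apply: sub; right.
by apply: subgroup_zpow => //; apply: sub; left.
Qed.

(** The exponent starts at 1 because the zeroth power of a set is [[set 1]], not the identity coset
    [A]. *)
Lemma root_coset_pow x (n : nat) : D x ->
  set_pow (set_mul A [set x]) n.+1 =
  [set y | D y /\ exists m : int, psi y = (n.+1%:R * psi x + m%:~R * psi a)%R].
Proof.
move=> Dx; have DV := subgroupV sD Dx.
elim: n => [|n IHn]; apply/seteqP; split.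
- move=> _ [_ [y [Dy [m ym]] [_ -> <-]] [_ -> <-]]; rewrite mulg1.
  by split; [exact: subgroupM|exists m; rewrite psiM // ym mul1r addrC].
- move=> y [Dy [m ym]]; exists y; last by exists 1; rewrite ?mulg1.
  exists (y / x); last by exists x; rewrite ?mulgVK.
  split; first exact: subgroupM.
  by exists m; rewrite (hom_onB sD psiM) // ym mul1r addrC addKr.
- rewrite /set_pow iterS -/(set_pow _ n.+1) IHn.
  move=> _ [_ [y [Dy [m ym]] [_ -> <-]] [z [Dz' [k zk]] <-]].
  have Dyx := subgroupM sD Dy Dx.
  split; first exact: subgroupM.
  exists (m + k)%R; rewrite !psiM // ym zk intrD -(addn1 n.+1) natrD; ring.
- move=> y [Dy [m ym]]; rewrite /set_pow iterS -/(set_pow _ n.+1) IHn.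
  exists x; first exact: coset_mem root_subgroup_subgroup.
  exists (x^-1 * y); last by rewrite mulVKg.
  split; first exact: subgroupM.
  exists m; rewrite psiM // (hom_onV sD psiM) // ym -(addn1 n.+1) natrD; ring.
Qed.

Lemma root_subgroup_pure x (n : nat) : torsion_free_quotient D A ->
  (0 < n)%N -> D x -> A (x ^+ n) -> A x.
Proof.
case: n => // n tf _ Dx [_ [m xm]].
have -> : A = set_mul A [set x].
  apply/esym/(tf _ n.+1) => //; first by exists x.
  move: xm; rewrite (hom_onX sD psiM) // => xm.
  rewrite root_coset_pow // xm; apply/seteqP; split=> y [Dy [k yk]]; split=> //.
    by exists (m + k)%R; rewrite yk intrD mulrDl.
  by exists (k - m)%R; rewrite yk intrB -mulrDl addrC subrK.
exact: coset_mem root_subgroup_subgroup.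
Qed.

(** [psi / psi a] is an integer exactly on [A]. An element with a rational value has a positive
    power in [A], hence lies in [A] by torsion-freeness; so composing with an additive map of kernel
    the rationals gives kernel [A]. *)
Lemma quotient_character : torsion_free_quotient D A ->
  exists chi : G -> R, hom_on D chi /\
    forall x, A x <-> D x /\ chi x = 0%R.
Proof.
move=> tf; have [theta [thetaD theta0]] := additive_kernel_rat R.
exists (fun x => theta (psi x / psi a)%R); split=> [x y Dx Dy|x].
  by rewrite psiM // mulrDl thetaD.
rewrite theta0; split=> [[Dx [m xm]]|[Dx [q xq]]].
  by split=> //; exists m%:~R%R; rewrite xm mulfK // ratr_int.
have q0 : (0 < `|denq q|)%N by rewrite absz_gt0 denq_neq0.
apply: (root_subgroup_pure tf q0 Dx); split; first exact: subgroupX.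
exists (numq q); rewrite (hom_onX sD psiM) // -(divfK psia (psi x)) xq mulrA.
congr (_ * _)%R; rewrite pmulrn absz_denq /ratr.
by rewrite mulrCA divff ?mulr1 // intr_eq0 denq_neq0.
Qed.

(** The nonnegative powers of [a]: the quotient is the exponent. Dividing by [psi a] makes [a]
    positive even if it is negative for [lt]. *)
Definition cyclic_cone : set G := [set x | Z x /\ (0 <= psi x / psi a)%R].

Definition root_cone : set G :=
  [set x | exists m c, [/\ C c, le lt 1 c & x = zpow a m * c]].

Definition upper_cone : set G := [set x | D x \/ lt 1 x].

Let psiMZ : hom_on Z (fun x => psi x / psi a)%R.
Proof. by move=> _ _ [m _ <-] [n _ <-]; rewrite psiM // mulrDl. Qed.

Lemma cyclic_cone_cone : cone Z cyclic_cone.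
Proof. exact: hom_cone. Qed.

Lemma cyclic_cone_units x : cyclic_cone x /\ cyclic_cone x^-1 -> x = 1.
Proof.
move=> [[Zx x0] [_]]; rewrite (hom_onV sZ psiMZ) // oppr_ge0 => x0'.
case: Zx x0 x0' => m _ <-; rewrite (hom_on_zpow sD psiM) // mulfK //.
by rewrite ler0z lerz0 => m0 m0'; have -> : m = 0%R by lia.
Qed.

(** Multiplying or inverting conjugates the [C]-part by a power of [a], which preserves [C] and,
    since [lt] is two-sided, the order. *)
Lemma root_cone_cone : cone A root_cone.
Proof.
split.
- exact: root_subgroup_subgroup.
- by move=> x [m [c [Cc _ ->]]]; apply/root_subgroupP; exists m, c.
- move=> _ _ [m [c [Cc c1 ->]]] [n [d [Cd d1 ->]]].
  exists (m + n)%R, (c ^ zpow a n * d); rewrite root_decompM; split=> //.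
    by apply: subgroupM => //; apply: conj_jump_lower.
  rewrite -[1]mulg1; apply: leo_mul => //.
  by rewrite -(conj1g (zpow a n)); apply: leo_conj.
- move=> x /root_subgroupP[m [c [Cc ->]]].
  case: (leo1V lt_ord c) => c1; [left|right].
    by exists m, c.
  rewrite root_decompV; exists (- m)%R, (c^-1 ^ zpow a (- m)); split=> //.
    by apply: conj_jump_lower; apply: subgroupV.
  by rewrite -(conj1g (zpow a (- m))); apply: leo_conj.
Qed.

Lemma root_cone_units x : Z x <-> root_cone x /\ root_cone x^-1.
Proof.
split=> [[m _ <-]|[[m [c [Cc c1 xE]]] [n [d [Cd d1 xVE]]]]].
  split; [exists m, 1|exists (- m)%R, 1]; rewrite mulg1 ?zpowN; split=> //.
  - exact: subgroup1.
  - by left.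
  - exact: subgroup1.
  - by left.
(* Comparing [C]-parts in [x * x^-1 = 1] writes 1 as a product of a conjugate of [c] and [d], both
   at least 1; hence [d = 1]. *)
have := mulgV x; rewrite {1}xE xVE root_decompM -[X in _ = X](mulg1 (zpow a 0)).
move=> e; have [||_ cd] := root_decomp_uniq _ _ e.
- by apply: subgroupM => //; apply: conj_jump_lower.
- exact: subgroup1.
have d_le1 : le lt d 1.
  rewrite -cd -{1}[d]mul1g; apply: leo_mul2r => //.
  by rewrite -(conj1g (zpow a n)); apply: leo_conj.
have d_eq1 := leo_anti lt_ord d_le1 d1.
by apply: (subgroupVE sZ); rewrite xVE d_eq1 mulg1; exists n.
Qed.

Lemma upper_cone_cone : cone setT upper_cone.
Proof.
split=> //.
- move=> x y Vx Vy; case: (lto_total lt_ord 1 (x * y)) => [xy1|<-|xy1].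
  + by right.
  + by left; apply: subgroup1.
  (* Now [x * y] is below 1. If one factor is in [D] and the other is above 1, the latter is below
     the inverse of the former, so convexity puts it in [D]; two factors above 1 are impossible. *)
  left; case: Vx Vy => [Dx|x1] [Dy|y1].
  + exact: subgroupM.
  + apply: subgroupM => //; apply: (convex_mem cD (subgroupV sD Dx) y1).
    by move/(lto_mul2l lt_ord x^-1): xy1; rewrite mulKg mulg1.
  + apply: subgroupM => //; apply: (convex_mem cD (subgroupV sD Dy) x1).
    by move/(lto_mul2r lt_ord y^-1): xy1; rewrite mulgK mul1g.
  + have := lto_mul2l lt_ord x y1; rewrite mulg1 => /(lto_trans lt_ord x1).
    by move=> /(lto_asym lt_ord).
- move=> x _; case: (leo1V lt_ord x) => -[<-|x1]; rewrite ?invg1.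
  + by left; left; apply: subgroup1.
  + by left; right.
  + by right; left; apply: subgroup1.
  + by right; right.
Qed.

Lemma upper_cone_units x : D x <-> upper_cone x /\ upper_cone x^-1.
Proof.
split=> [Dx|[[//|x1] [/(subgroupVE sD)//|xV1]]].
  by split; left => //; apply: subgroupV.
have := lto_mul2l lt_ord x xV1; rewrite mulgV mulg1 => x1'.
by case: (lto_asym lt_ord x1 x1').
Qed.

(** The character is that of the jump of [g] for [lt]. Since [D] is convex and misses [g], it lies
    in the lower group, where the character vanishes. *)
Lemma upper_cone_archimedean : archimedean_cone R setT upper_cone.
Proof.
move=> g Vg VgV; have Dg : ~ D g by move=> /(subgroupV sD) ?; apply: VgV; left.
have g1 : lt 1 g by case: Vg.
have g_neq1 : g <> 1 by move=> e; apply: Dg; rewrite e; apply: subgroup1.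
have [phi [phiM phi_ge0 phi0]] := jump_hom R lt_ord g_neq1.
have DCg : D `<=` jump_lower lt g by apply: jump_lower_max.
have cL := jump_upper_convex lt g.
have DL : D `<=` jump_upper lt g by move=> x /DCg/phi0[].
have Lg := @jump_upper_gen _ lt g.
exists (jump_upper lt g), phi; split=> //; first by split=> //; case: cL.
- move=> x y [/DL//|x1] [Dy|y1] Lyx.
    by apply: (subgroupMl cL.1) Lyx; apply: DL.
  apply: (convex_mem cL Lyx x1).
  by have := lto_mul2r lt_ord x y1; rewrite mul1g.
- move=> x Lx [/DCg/phi0[_ ->]//|x1]; exact: phi_ge0.
rewrite lt_neqAle phi_ge0 // andbT; apply/eqP => /esym g0.
by apply: (@jump_lowerN _ lt g); apply/phi0.
Qed.

(** * Conjugation by [a] inside the jumps *)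

Section CommutingCase.
Hypothesis commute_jumps : forall E F : set G, convex_jump lt E F ->
  commutator_subgroup a F `<=` E.

Lemma jump_commutator c x : c <> 1 -> jump_upper lt c x ->
  jump_lower lt c (x ^ a / x).
Proof.
move=> c1 Dx; apply: (commute_jumps (jump_convex_jump lt_ord.1 c1)).
(* The commutator of [a] with [x^-1] is [x ^ a / x]. *)
apply: sub_generated; exists x^-1; last by rewrite commgEr invgK.
exact: (subgroupV (jump_upper_convex lt c).1 Dx).
Qed.

Section Jump.
Variables (c : G) (K : set G) (phi : G -> R).
Hypotheses (c_neq1 : c <> 1) (KE : K = jump_upper lt c).
Hypothesis phiM : hom_on K phi.
Hypothesis phi_ker : forall x, jump_lower lt c x <-> K x /\ phi x = 0%R.

Let cK : convex_subgroups lt K. Proof. by rewrite KE; apply: jump_upper_convex. Qed.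
Let sK : subgroup K. Proof. exact: cK.1. Qed.

Lemma jump_conj x : K x -> K (x ^ a) /\ phi (x ^ a) = phi x.
Proof.
move=> Kx; have [|Kcx cx0] := (phi_ker _).1 (@jump_commutator c x c_neq1 _).
  by rewrite -KE.
rewrite -(mulgVK x (x ^ a)) phiM // cx0 add0r; split=> //.
exact: subgroupM.
Qed.

(* [f ^ a] and [f] lie in the same jump [E >-> F], since [f ^ a / f] is in [E];
   so [f] cannot leave a jump which contains [f ^ a]. *)
Lemma jump_conjV x : K x -> K (x ^ a^-1) /\ phi (x ^ a^-1) = phi x.
Proof.
move=> Kx; set k := x ^ a^-1; have kx : k ^ a = x by rewrite conjgKV.
suff Kk : K k by have [_ <-] := jump_conj Kk; rewrite kx.
case: (pselect (k = 1)) => [->|k1]; first exact: subgroup1.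
apply: contrapT => Kk.
have := jump_commutator k1 (@jump_upper_gen _ lt k); rewrite kx.
have sCk := (jump_lower_convex lt_ord.1 k1).1.
move=> /(subgroupMl sCk (jump_lower_max cK Kk Kx))/(subgroupVE sCk).
exact: jump_lowerN.
Qed.

Lemma jump_conj_zpow m x : K x -> K (x ^ zpow a m) /\ phi (x ^ zpow a m) = phi x.
Proof.
(* [N] is closed under products only; the elements lying in [N] with their inverses form a subgroup,
   which contains [a]. *)
pose N : set G := [set z | forall y, K y -> K (y ^ z) /\ phi (y ^ z) = phi y].
have NM z w : N z -> N w -> N (z * w).
  move=> Nz Nw y Ky; have [Kyz <-] := Nz y Ky; rewrite conjgM; exact: Nw.
have sN : subgroup [set z | N z /\ N z^-1].
  split; first by split=> y Ky; rewrite ?invg1 conjg1.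
  by move=> z w [Nz NzV] [Nw NwV]; split; [|rewrite invgF]; apply: NM.
have [] : [set z | N z /\ N z^-1] (zpow a m).
  by apply: subgroup_zpow => //; split; [exact: jump_conj|exact: jump_conjV].
by move=> Nz _; apply: Nz.
Qed.

End Jump.

(** For [g] with [C]-part [c], the subgroup is [Z K], where [K] is the upper group of the jump of
    [c], and the character is that of the jump applied to the [C]-part. *)
Lemma root_cone_archimedean : archimedean_cone R A root_cone.
Proof.
move=> _ [m [c [Cc c1 ->]]] gV.
have {c1} c1 : lt 1 c.
  case: c1 => // c1; case: gV; rewrite -c1 mulg1 -zpowN.
  have /root_cone_units[] // : Z (zpow a (- m)) by exists (- m)%R.
have c_neq1 : c <> 1 by move=> e; apply: (@lto_irr _ _ lt_ord 1); rewrite -{2}e.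
have [phi [phiM phi_ge0 phi_ker]] := jump_hom R lt_ord c_neq1.
have cK := jump_upper_convex lt c; have sK := cK.1.
have Kc := @jump_upper_gen _ lt c.
have KC : jump_upper lt c `<=` C by apply: jump_upper_min.
move KE: (jump_upper lt c) => K in phiM phi_ge0 phi_ker cK sK Kc KC.
have Kz n x : K x -> K (x ^ zpow a n).
  by move=> Kx; case: (jump_conj_zpow c_neq1 (esym KE) phiM phi_ker n Kx).
have phiz n x : K x -> phi (x ^ zpow a n) = phi x.
  by move=> Kx; case: (jump_conj_zpow c_neq1 (esym KE) phiM phi_ker n Kx).
pose part x := xget 1 [set d | C d /\ exists n, x = zpow a n * d].
have partE n d : C d -> part (zpow a n * d) = d.
  move=> Cd.
  have [Ce [k e]] : [set e | C e /\ exists k, zpow a n * d = zpow a k * e]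
      (part (zpow a n * d)).
    by apply: xgetPex; exists d; split=> //; exists n.
  by have [_ /esym] := root_decomp_uniq Cd Ce e.
pose L : set G := [set x | exists n d, K d /\ x = zpow a n * d].
exists L, (phi \o part); split.
- split.
  + split; first by exists 0%R, 1; rewrite mulg1; split=> //; apply: subgroup1.
    move=> _ _ [n [d [Kd ->]]] [k [e [Ke ->]]].
    rewrite root_decompV root_decompM; do 2 eexists; split; last reflexivity.
    apply: subgroupM => //; apply: Kz => //.
    exact: subgroupV.
  + by move=> x [n [d [/KC Cd ->]]]; apply/root_subgroupP; exists n, d.
  + by exists m, c.
(* Convexity: the [C]-part [d] of the product is a conjugate of [v] times [u], so [u] lies between 1
   and [d], hence in [K]. *)
- move=> _ _ [n [u [Cu u1 ->]]] [k [v [Cv v1 ->]]] [l [d [Kd]]].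
  rewrite root_decompM => e; exists n, u; split=> //.
  have Cvn := conj_jump_lower n Cv.
  have [_ vud] := root_decomp_uniq (subgroupM sC Cvn Cu) (KC _ Kd) e.
  case: u1 => [<-|u1]; first exact: subgroup1.
  have : le lt u d.
    rewrite -vud -{1}[u]mul1g; apply: leo_mul2r => //.
    by rewrite -(conj1g (zpow a n)); apply: leo_conj.
  case=> [->//|ud]; exact: (convex_mem cK Kd u1).
(* Additivity holds because [phi] is invariant under conjugation by powers of [a]. *)
- move=> _ _ [n [d [Kd ->]]] [k [e [Ke ->]]].
  have Kdk := Kz k _ Kd; have Kde := subgroupM sK Kdk Ke.
  rewrite root_decompM /= (partE _ _ (KC _ Kd)) (partE _ _ (KC _ Ke)).
  by rewrite (partE _ _ (KC _ Kde)) phiM ?phiz.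
- move=> _ [n [d [Kd ->]]] [k [e [Ce e1]]].
  move=> /(root_decomp_uniq (KC _ Kd) Ce)[_ de]; rewrite /= partE; last exact: KC.
  case: e1 => [e1|e1]; last by apply: phi_ge0; rewrite // de.
  by rewrite de -e1 (hom_on1 sK phiM).
rewrite /= partE // lt_neqAle phi_ge0 // andbT; apply/eqP => /esym c0.
by apply: (@jump_lowerN _ lt c); apply/phi_ker.
Qed.

End CommutingCase.

(** * Assembly of the discrete order *)

Hypothesis tf : torsion_free_quotient D (generated ([set a] `|` C)).

(** The cones are combined from the top down: 4 on [G] over [D], 3 on [D] over [A], 2 on [A] over
    [Z], and lastly the one on [Z]. The digits in the names below record which are already combined.
    The same [V] serves both claims of the theorem. *)
Lemma discrete_cone : exists V : set G,
  [/\ cone setT V, forall x, V x -> V x^-1 -> x = 1,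
      minimal_positive (cone_order V) a &
      (forall E F : set G, convex_jump lt E F -> commutator_subgroup a F `<=` E) ->
      archimedean_cone R setT V].
Proof.
have [chi [chiM chi0]] : exists chi : G -> R, hom_on D chi /\
    forall x, A x <-> D x /\ chi x = 0%R.
  by apply: quotient_character; rewrite -generated_root.
pose quotient_cone : set G := [set x | D x /\ (0 <= chi x)%R].
have cone3 : cone D quotient_cone := hom_cone sD chiM.
have units3 x : A x <-> quotient_cone x /\ quotient_cone x^-1.
  rewrite chi0; split=> [[Dx x0]|[[Dx x0] [DxV]]].
    split; split; rewrite ?x0 //; first exact: subgroupV.
    by rewrite (hom_onV sD chiM) // x0 oppr0.
  rewrite (hom_onV sD chiM) // oppr_ge0 => x0'; split=> //.
  by apply/eqP; rewrite eq_le x0 x0'.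
have cone43 := cone_ext_cone cone3 upper_cone_cone upper_cone_units.
have units43 x : A x <-> cone_ext upper_cone quotient_cone x /\
    cone_ext upper_cone quotient_cone x^-1.
  by rewrite units3 (cone_ext_units cone3 upper_cone_units).
have cone432 := cone_ext_cone root_cone_cone cone43 units43.
set V432 := cone_ext _ root_cone in cone432.
have units432 x : Z x <-> V432 x /\ V432 x^-1.
  by rewrite (cone_ext_units root_cone_cone units43) root_cone_units.
have coneV := cone_ext_cone cyclic_cone_cone cone432 units432.
set V := cone_ext _ cyclic_cone in coneV.
have unitsV x : V x -> V x^-1 -> x = 1.
  move=> Vx VxV; apply: cyclic_cone_units.
  by apply/(cone_ext_units cyclic_cone_cone units432).
have Za : Z a by exists 1%R; rewrite ?zpow1.
exists V; split=> //.
  split; first split; first by move/esym.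
    rewrite divg1; split; first by have [] := (units432 a).1 Za.
    by move=> _; split; rewrite ?divff.
  (* If [x] lies between 1 and [a], then [x] and [a / x] are in [V] with product [a] in [Z], so both
     are in [cyclic_cone]. Thus [x] is a power of [a] with exponent 0 or 1. *)
  move=> x [[x1]]; rewrite divg1 => Vx [xa Vax].
  have [|V1x V1ax] := cone_ext_mem cone432 units432 Vx Vax; first by rewrite mulgVK.
  case: V1x V1ax => -[m _ mx] m0 [_]; rewrite (hom_onB sD psiM) -?mx //.
  move: m0; rewrite -mx (hom_on_zpow sD psiM) // mulrBl !mulfK // divff //.
  rewrite subr_ge0 ler0z lerz1 => m0 m1.
  have [m_eq|m_eq] : m = 0%R \/ m = 1%R by lia.
    by apply: x1; rewrite -mx m_eq.
  by apply: xa; rewrite -mx m_eq zpow1.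
move=> commute_jumps.
apply: (cone_ext_archimedean cyclic_cone_cone cone432 units432).
  exact: hom_cone_archimedean.
apply: (cone_ext_archimedean root_cone_cone cone43 units43).
  exact: root_cone_archimedean.
apply: (cone_ext_archimedean cone3 upper_cone_cone upper_cone_units).
  exact: hom_cone_archimedean.
exact: upper_cone_archimedean.
Qed.

End Construction.

Theorem theorem3p5 (R : realType) (G : groupType) (lt : G -> G -> Prop)
    (a : G) (C D : set G) :
  group_order lt -> a <> 1 ->
  C = jump_lower lt a -> D = jump_upper lt a ->
  torsion_free_quotient D (generated ([set a] `|` C)) ->
  (exists lt' : G -> G -> Prop, right_order lt' /\ minimal_positive lt' a) /\
  ((forall E F : set G, convex_jump lt E F ->
      commutator_subgroup a F `<=` E) ->
   exists lt' : G -> G -> Prop,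
     [/\ right_order lt', lexicographic R lt' & minimal_positive lt' a]).
Proof.
move=> ltO a1 -> -> tf.
have [psi [psiM _ psi0]] := jump_hom R ltO a1.
have [V [coneV units1 minV archV]] := discrete_cone ltO a1 erefl erefl psiM psi0 tf.
have rV := cone_order_right coneV units1.
split; first by exists (cone_order V).
by move=> /archV arch; exists (cone_order V); split=> //; apply: cone_order_lexicographic.
Qed.
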